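(* Let $C$ be an open convex subset of a real reflexive Banach space $X$, and let $f\colon C\to\mathbb{R}$ be a continuous convex function. Let $I\subset\mathbb{R}$ be an open interval containing $f(C)$. Then, for every real normed linear space $Z$ and every d.c. mapping $G\colon I\to Z$, the composed map $G\circ f\colon C\to Z$ is d.c. on $C$.
   Context: Let $X,Y$ be real normed linear spaces and $C\subset X$ convex. A continuous mapping $F\colon C\to Y$ is called d.c. (delta-convex) if there is a continuous function $f\colon C\to\mathbb{R}$ (a control function of $F$) such that $y^*\circ F+f$ is convex on $C$ for every $y^*\in Y^*$ with $\|y^*\|\le 1$. *)

(* Defs.v *)
From HB Require Import structures.
From mathcomp Require Import all_boot all_order all_algebra.
From mathcomp Require Import all_classical all_reals all_analysis.

Set Implicit Arguments.
Unset Strict Implicit.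
Unset Printing Implicit Defensive.

Import Order.TTheory GRing.Theory Num.Theory.
Import numFieldNormedType.Exports.

Local Open Scope classical_set_scope.
Local Open Scope ring_scope.

Section topological_dual.
Context {R : realType} (V : normedModType R).

Definition in_dual : {pred V -> R^o} :=
  [pred f : V -> R^o | `[< linear f /\ continuous f >]].

Lemma in_dual_submod_closed : submod_closed in_dual.
Proof.
split.
  apply/asboolP; split; last by move=> x; exact: cvg_cst.
  by move=> a u v; rewrite /= scaler0 addr0.
move=> a f g /asboolP[lf cf] /asboolP[lg cg].
apply/asboolP; split.
  move=> b u v; rewrite -[LHS]/(a *: f (b *: u + v) + g (b *: u + v)).
  rewrite -[RHS]/(b *: (a *: f u + g u) + (a *: f v + g v)).
  by rewrite lf lg !scalerDr !scalerA mulrC addrACA.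
by move=> x; apply: cvgD; [apply: cvgZr; exact: cf|exact: cg].
Qed.

HB.instance Definition _ :=
  GRing.isSubmodClosed.Build R (V -> R^o) in_dual in_dual_submod_closed.

Record dual : Type := Dual {
  dual_fun :> V -> R^o ;
  dual_funP : dual_fun \in in_dual }.

HB.instance Definition _ := [isSub for dual_fun].
HB.instance Definition _ := [Choice of dual by <:].
HB.instance Definition _ := [SubChoice_isSubLmodule of dual by <:].

Lemma dual_linear (f : dual) : linear f.
Proof. by have /asboolP[] := dual_funP f. Qed.

Lemma dual_continuous (f : dual) : continuous f.
Proof. by have /asboolP[] := dual_funP f. Qed.

HB.instance Definition _ (f : dual) :=
  GRing.isLinear.Build R V R^o *:%R f (dual_linear f).

Definition dual_norm (f : dual) : R :=
  sup [set `|f x| | x in [set x : V | `|x| <= 1]].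

Lemma dual_norm_has_sup (f : dual) :
  has_sup [set `|f x| | x in [set x : V | `|x| <= 1]].
Proof.
split; first by exists `|f 0|, 0 => //=; rewrite normr0.
have /bounded_funP/(_ 1)[M fM] :=
  continuous_linear_bounded 0 (@dual_continuous f 0).
by exists M => _ [x /= x1 <-]; exact: fM.
Qed.

Lemma le_dual_norm (f : dual) (x : V) : `|f x| <= dual_norm f * `|x|.
Proof.
have [->|x0] := eqVneq x 0; first by rewrite linear0 !normr0 mulr0.
have x_gt0 : 0 < `|x| by rewrite normr_gt0.
rewrite -ler_pdivrMr//.
have -> : `|f x| / `|x| = `|f (`|x|^-1 *: x)|.
  by rewrite linearZ normrZ ger0_norm ?invr_ge0// mulrC.
apply: sup_upper_bound; first exact: dual_norm_has_sup.
by exists (`|x|^-1 *: x) => //=; rewrite normrZ ger0_norm ?invr_ge0// mulVf// gt_eqF.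
Qed.

Lemma dual_norm_le (f : dual) (M : R) :
  (forall x, `|x| <= 1 -> `|f x| <= M) -> dual_norm f <= M.
Proof.
move=> fM; apply: ge_sup; first by case: (dual_norm_has_sup f).
by move=> _ [x /= x1 <-]; exact: fM.
Qed.

Lemma dual_norm_ge0 (f : dual) : 0 <= dual_norm f.
Proof.
apply: (le_trans (normr_ge0 (f 0))).
apply: sup_upper_bound; first exact: dual_norm_has_sup.
by exists 0 => //=; rewrite normr0.
Qed.

Lemma le_dual_norm1 (f : dual) (x : V) : `|x| <= 1 -> `|f x| <= dual_norm f.
Proof.
move=> x1; apply: le_trans (le_dual_norm f x) _.
by rewrite ler_piMr// dual_norm_ge0.
Qed.

Lemma dual_normD (f g : dual) : dual_norm (f + g) <= dual_norm f + dual_norm g.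
Proof.
apply: dual_norm_le => x x1.
by rewrite (le_trans (ler_normD _ _))// lerD// le_dual_norm1.
Qed.

Let dual_normZ_le (a : R) (f : dual) : dual_norm (a *: f) <= `|a| * dual_norm f.
Proof.
apply: dual_norm_le => x x1.
by rewrite -[(a *: f) x]/(a *: f x) normrZ ler_wpM2l// le_dual_norm1.
Qed.

Lemma dual_normZ (a : R) (f : dual) : dual_norm (a *: f) = `|a| * dual_norm f.
Proof.
apply/eqP; rewrite eq_le dual_normZ_le/=.
have [->|a0] := eqVneq a 0; first by rewrite normr0 mul0r dual_norm_ge0.
rewrite -ler_pdivlMl ?normr_gt0//.
by rewrite -[in leLHS](scalerK a0 f) (le_trans (dual_normZ_le _ _))// normfV.
Qed.

Lemma dual_norm0_eq0 (f : dual) : dual_norm f = 0 -> f = 0.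
Proof.
move=> f0; apply/val_inj/funext => x /=; apply/eqP.
by rewrite -normr_le0 (le_trans (le_dual_norm f x))// f0 mul0r.
Qed.

HB.instance Definition _ :=
  Lmodule_isNormed.Build R dual dual_normD dual_normZ dual_norm0_eq0.

End topological_dual.

Section canonical_embedding.
Context {R : realType} (V : normedModType R).

Lemma bidual_eval_in_dual (x : V) :
  (fun f : dual V => f x : R^o) \in @in_dual R (dual V).
Proof.
apply/asboolP.
have evl : linear (fun f : dual V => f x : R^o) by [].
split=> //.
pose ev : {linear dual V -> R^o} :=
  HB.pack (fun f : dual V => f x : R^o)
    (GRing.isLinear.Build R (dual V) R^o *:%R _ evl).
apply: (@bounded_linear_continuous _ _ _ ev); apply/bounded_funP => r.
exists (r * `|x|) => f fr; apply: le_trans (le_dual_norm f x) _.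
exact: ler_wpM2r.
Qed.

Definition bidual_eval (x : V) : dual (dual V) := Dual (bidual_eval_in_dual x).

Definition reflexive_space : Prop := range bidual_eval = setT.

End canonical_embedding.

Section delta_convex.
Context {R : realType} {X Y : normedModType R}.

Definition control_function (C : set X) (F : X -> Y) (f : X -> R^o) : Prop :=
  {within C, continuous f} /\
  forall y : dual Y, `|y| <= 1 -> convex_function C (fun x => y (F x) + f x).

(* Maps on C are total functions on X of which only the values on C matter;
   [{within C, continuous F}] is continuity for the topology induced on C. *)
Definition dc_mapping (C : set X) (F : X -> Y) : Prop :=
  {within C, continuous F} /\ exists f : X -> R^o, control_function C F f.

End delta_convex.

(* Main.v *)
(* Let [g] be a control function of [G] on [I].  For each [b] in [I] there is
   [l >= 0] such that all the functions [y \o G + g + l * id] with [|y| <= 1]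
   are nondecreasing to the right of [b], so that [y \o G \o f + g \o f + l * f]
   satisfies the convexity inequality at every point where [f >= b].  Hence [G \o f]
   is easily controlled on any set where [f] is bounded below in [I], and the
   difficulty is that the constants [l] blow up when [f] approaches the left
   endpoint of [I].

   Choose a convex continuous [W] on [C] that dominates [|f|] and the norm and
   has closed sublevel sets.  Those sublevel sets are bounded, so by reflexivity
   [f] is bounded below on each of them by an element of [I]; call [l_n] the
   resulting constant on [W <= n + 1].  The function
     [h_n = max (l_n * (f + (2 n + 1) * W - 2 n^2)) 0]
   vanishes where [W <= n - 1] and equals its first argument, which contains the
   term [l_n * f], where [W >= n].  So [H = \sum_n h_n] is a locally finite sum
   of convex functions, and [g \o f + H] controls [G \o f]: at a point [z] with
   [n <= W z < n + 1] the summand [h_n] compensates the lack of monotonicity. *)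

Require Import Defs.
From HB Require Import structures.
From mathcomp Require Import all_boot all_order all_algebra.
From mathcomp Require Import all_classical all_reals all_analysis.
From mathcomp Require Import lra ring.

Import Order.TTheory GRing.Theory Num.Theory.
Import numFieldNormedType.Exports.

Local Open Scope classical_set_scope.
Local Open Scope ring_scope.

(** * Linear minorants of sublinear functions *)

Section hahn_banach.
Context {R : realType} {V : lmodType R}.
Implicit Types p q : V -> R.

(** Homogeneity is asked only as [<=], the part that is easy to check; applying it to the inverse
    scalar recovers equality, as in [sublinearZ]. *)
Definition sublinear p :=
  (forall x y, p (x + y) <= p x + p y) /\
  (forall t x, 0 <= t -> p (t *: x) <= t * p x).

Lemma sublinear0 p : sublinear p -> p 0 = 0.
Proof.
move=> [pD pZ]; apply/eqP; rewrite eq_le; apply/andP; split.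
  by have := pZ 0 0 (lexx _); rewrite scale0r mul0r.
by have := pD 0 0; rewrite addr0 -[leLHS]addr0 lerD2l.
Qed.

Lemma sublinear_geN p x : sublinear p -> - p (- x) <= p x.
Proof.
move=> sp; have := sp.1 x (- x).
by rewrite subrr (sublinear0 _ sp) addrC -lerBlDl sub0r.
Qed.

Lemma sublinearZ p t x : sublinear p -> 0 <= t -> p (t *: x) = t * p x.
Proof.
move=> sp; rewrite le_eqVlt => /predU1P[<-|t0].
  by rewrite scale0r mul0r sublinear0.
apply/eqP; rewrite eq_le (sp.2 _ _ (ltW t0))/= -ler_pdivlMl//.
rewrite -[in leLHS](scalerK (lt0r_neq0 t0) x).
by apply: sp.2; rewrite invr_ge0 ltW.
Qed.

(* For a minimal sublinear [p] the shift, being below [p], must equal [p]; at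
   [t = 1] this gives the additivity of [p]. *)
Definition sublinear_shift p x v :=
  inf [set p (v + t *: x) - t * p x | t in [set t | 0 <= t]].

Lemma sublinear_shift_le p x v t : sublinear p -> 0 <= t ->
  sublinear_shift p x v <= p (v + t *: x) - t * p x.
Proof.
move=> sp t0; apply: ge_inf; last by exists t.
(* This lower bound makes the infimum meaningful: [s * p x = p (s *: x)] is at most
   [p (v + s *: x) + p (- v)]. *)
exists (- p (- v)) => _ [s /= s0 <-].
rewrite lerBrDr -sublinearZ// addrC -lerBrDr opprK.
by apply: le_trans (sp.1 _ _); rewrite addrAC subrr add0r.
Qed.

Lemma le_sublinear_shift p x v a :
  (forall t, 0 <= t -> a <= p (v + t *: x) - t * p x) ->
  a <= sublinear_shift p x v.
Proof.
move=> ap; apply: lb_le_inf; first by exists (p (v + 0 *: x) - 0 * p x), 0 => /=.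
by move=> _ [t /= t0 <-]; exact: ap.
Qed.

(** Parameters [t] for [u] and [s] for [w] combine into [t + s] for [u + w], and a parameter [t] for
    [u] rescales to [s * t] for [s *: u]. *)
Lemma sublinear_shift_sublinear p x :
  sublinear p -> sublinear (sublinear_shift p x).
Proof.
move=> sp; split=> [u w|s u s0].
  rewrite -lerBlDr; apply: le_sublinear_shift => t t0.
  rewrite lerBlDr -lerBlDl; apply: le_sublinear_shift => s s0.
  rewrite lerBlDl.
  apply: (le_trans (sublinear_shift_le _ x _ (t + s) sp (addr_ge0 t0 s0))).
  have := sp.1 (u + t *: x) (w + s *: x).
  by rewrite addrACA -scalerDl; lra.
have [->|s_neq0] := eqVneq s 0.
  rewrite scale0r mul0r.
  apply: (le_trans (sublinear_shift_le _ x _ 0 sp (lexx _))).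
  by rewrite scale0r addr0 mul0r subr0 sublinear0.
have s_gt0 : 0 < s by rewrite lt_neqAle eq_sym s_neq0.
rewrite -ler_pdivrMl//; apply: le_sublinear_shift => t t0.
rewrite ler_pdivrMl//.
apply: (le_trans (sublinear_shift_le _ x _ (s * t) sp (mulr_ge0 s0 t0))).
by rewrite -scalerA -scalerDr sublinearZ// mulrBr mulrA.
Qed.

Lemma minimal_sublinear_linear p : sublinear p ->
  (forall q, sublinear q -> (forall x, q x <= p x) -> forall x, p x <= q x) ->
  linear (p : V -> R^o).
Proof.
move=> sp minp.
have pD v x : p (v + x) = p v + p x.
  apply/eqP; rewrite eq_le sp.1 -lerBrDr/=.
  have q_le u : sublinear_shift p x u <= p u.
    apply: (le_trans (sublinear_shift_le _ x _ 0 sp (lexx _))).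
    by rewrite scale0r addr0 mul0r subr0.
  have := minp _ (sublinear_shift_sublinear _ x sp) q_le v.
  move=> /le_trans; apply.
  by have := sublinear_shift_le _ x v 1 sp ler01; rewrite scale1r mul1r.
have pN x : p (- x) = - p x.
  by apply/eqP; rewrite -subr_eq0 opprK -pD addNr sublinear0.
move=> a u v; rewrite pD; congr (_ + _).
have [a0|a0] := leP 0 a; first exact: sublinearZ.
by rewrite -[a *: u]opprK -scaleNr pN sublinearZ ?oppr_ge0 ?ltW// mulNr opprK.
Qed.

(** The pointwise infimum works. It is finite because every member is at least [- p (- x)] at [x],
    and it is subadditive because, of two members of a chain, the smaller one serves for both
    summands. *)
Lemma sublinear_chain_inf p (A : set {q | sublinear q /\ forall x, q x <= p x}) :
  sublinear p -> A !=set0 ->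
  total_on A (fun s t => `[< forall x, sval t x <= sval s x >]) ->
  exists2 q, sublinear q & forall s, A s -> forall x, q x <= sval s x.
Proof.
move=> sp [s0 As0] Atot.
pose q x := inf [set sval s x | s in A].
have q_le s x : A s -> q x <= sval s x.
  move=> As; apply: ge_inf; last by exists s.
  exists (- p (- x)) => _ [[r [sr rp]] Ar <-] /=.
  by rewrite (le_trans _ (sublinear_geN _ x sr))// lerN2.
have le_q a x : (forall s, A s -> a <= sval s x) -> a <= q x.
  move=> aA; apply: lb_le_inf; first by exists (sval s0 x), s0.
  by move=> _ [s As <-]; exact: aA.
exists q; last by move=> s As x; exact: q_le.
split=> [u w|t u t0].
  rewrite -lerBlDr; apply: (le_q) => r1 Ar1.
  rewrite lerBlDr -lerBlDl; apply: (le_q) => r2 Ar2.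
  rewrite lerBlDl.
  have [/asboolP le21|/asboolP le12] := Atot _ _ Ar1 Ar2.
    apply: (le_trans (q_le _ _ Ar2)).
    by apply: (le_trans ((svalP r2).1.1 u w)); rewrite lerD2r.
  apply: (le_trans (q_le _ _ Ar1)).
  by apply: (le_trans ((svalP r1).1.1 u w)); rewrite lerD2l.
move: t0; rewrite le_eqVlt => /predU1P[<-|t0].
  rewrite scale0r mul0r; apply: (le_trans (q_le _ _ As0)).
  by rewrite sublinear0//; exact: (svalP s0).1.
rewrite -ler_pdivrMl//; apply: le_q => r Ar; rewrite ler_pdivrMl//.
apply: (le_trans (q_le _ _ Ar)); apply: (svalP r).1.2; exact: ltW.
Qed.

(** Zorn's lemma is applied to the sublinear functions below [p] with the order reversed, so that a
    maximal element is a minimal sublinear function, hence linear. *)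
Lemma linear_le_sublinear p : sublinear p ->
  exists2 phi : V -> R^o, linear phi & forall x, phi x <= p x.
Proof.
move=> sp.
pose T := {q | sublinear q /\ forall x, q x <= p x}.
pose ge (s t : T) := `[< forall x, sval t x <= sval s x >].
have p0 : T by exists p; split.
have [| | |q qmin] := @ZL_preorder T p0 ge.
- by move=> q; apply/asboolP.
- move=> r s t /asboolP rs /asboolP st; apply/asboolP => x.
  exact: le_trans (st x) (rs x).
- move=> A Atot; have [A0|/nonemptyPn A0] := pselect (A !=set0); last first.
    by exists p0 => s; rewrite A0.
  have [q sq qA] := sublinear_chain_inf _ _ sp A0 Atot.
  have qp : forall x, q x <= p x.
    move=> x; have [s As] := A0.
    by apply: le_trans (qA _ As x) _; exact: (svalP s).2.
  by exists (exist _ q (conj sq qp)) => s As; apply/asboolP; exact: qA.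
exists (sval q); last exact: (svalP q).2.
apply: minimal_sublinear_linear => [|r sr rq]; first exact: (svalP q).1.
have rp x : r x <= p x by apply: le_trans (rq x) _; exact: (svalP q).2.
have /(_ _)/asboolP := qmin (exist _ r (conj sr rp)).
by apply; apply/asboolP.
Qed.

End hahn_banach.

(** * Bounded convex sets in reflexive spaces *)

Lemma convex_setP {R : realType} {V : lmodType R} (C : set V) :
  convex_set C <->
  forall x y s t, C x -> C y -> 0 <= s -> 0 <= t -> s + t = 1 ->
    C (s *: x + t *: y).
Proof.
split=> [cC x y s t Cx Cy s0 t0 st|cC x y l /set_mem Cx /set_mem Cy]; last first.
  by apply/mem_set; apply: cC => //; rewrite ?subr_ge0 ?le1// addrC subrK.
have s1 : s <= 1 by rewrite -st lerDl.
have := cC x y (Itv01 s0 s1) (mem_set Cx) (mem_set Cy).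
by move=> /set_mem; have -> : t = 1 - s by rewrite -st addrAC subrr add0r.
Qed.

Lemma convex_functionP {R : realType} {V : lmodType R} (C : set V)
    (f : V -> R^o) :
  convex_function C f <->
  forall x y s t, C x -> C y -> 0 <= s -> 0 <= t -> s + t = 1 ->
    f (s *: x + t *: y) <= s * f x + t * f y.
Proof.
split=> [cf x y s t Cx Cy s0 t0 st|cf l x y /set_mem Cx /set_mem Cy]; last first.
  by apply: cf => //; rewrite ?subr_ge0 ?le1// addrC subrK.
have s1 : s <= 1 by rewrite -st lerDl.
have := cf (Itv01 s0 s1) x y (mem_set Cx) (mem_set Cy).
by have -> : t = 1 - s by rewrite -st addrAC subrr add0r.
Qed.

Section separation.
Context {R : realType} {V : normedModType R}.

Lemma linear_le_norm_in_dual (phi : V -> R^o) :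
  linear phi -> (forall x, phi x <= `|x|) -> phi \in @in_dual R V.
Proof.
move=> lphi phi_le; apply/asboolP; split=> //.
pose g : {linear V -> R^o} :=
  HB.pack phi (GRing.isLinear.Build R V R^o *:%R _ lphi).
apply: (@bounded_linear_continuous _ _ _ g); apply/bounded_funP => r.
exists r => x xr; apply: le_trans xr.
rewrite ler_norml phi_le andbT lerNl.
have -> : - g x = g (- x) by rewrite linearN.
by rewrite -[leRHS]normrN; exact: phi_le.
Qed.

Lemma convex_closed_separation (K : set V) (x0 : V) :
  closed K -> convex_set K -> ~ K x0 ->
  exists (phi : dual V) (r : R), 0 < r /\ forall k, K k -> phi x0 + r <= phi k.
Proof.
move=> Kclosed /convex_setP Kconvex nKx0.
have [[k0 Kk0]|/nonemptyPn K0] := pselect (K !=set0); last first.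
  by exists 0, 1; split=> // k; rewrite K0.
(* With [r] the distance from [x0] to [K], the sublinear function [p] below is
   bounded by the norm and is at most [- r] on [x0 - K]. *)
have [r /= r0 rK] : exists2 r : R, 0 < r & forall k, K k -> r <= `|x0 - k|.
  have : nbhs x0 (~` K) by apply: open_nbhs_nbhs; split=> //; exact: closed_openC.
  move=> /nbhs_ballP[r /= r0 xr]; exists r => // k Kk.
  rewrite leNgt; apply/negP => kr; apply: (xr k) => //.
  by rewrite -ball_normE.
pose D := [set tk : R * V | 0 <= tk.1 /\ K tk.2].
pose F (v : V) (tk : R * V) := `|v - tk.1 *: (x0 - tk.2)| - tk.1 * r.
pose p v := inf [set F v tk | tk in D].
have F_ge v tk : D tk -> - `|v| <= F v tk.
  move=> [t0 Kk]; rewrite /F.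
  have := ler_normB v (v - tk.1 *: (x0 - tk.2)).
  rewrite subKr normrZ (ger0_norm t0).
  have := ler_wpM2l t0 (rK _ Kk); lra.
have p_le v tk : D tk -> p v <= F v tk.
  move=> Dtk; apply: ge_inf; last by exists tk.
  by exists (- `|v|) => _ [tk' Dtk' <-]; exact: F_ge.
have le_p v a : (forall tk, D tk -> a <= F v tk) -> a <= p v.
  move=> aF; apply: lb_le_inf; first by exists (F v (0, k0)), (0, k0).
  by move=> _ [tk Dtk <-]; exact: aF.
have sp : sublinear p.
  split=> [u w|a u a0].
    rewrite -lerBlDr; apply: (le_p) => -[t k] [/= t0 Kk].
    rewrite lerBlDr -lerBlDl; apply: (le_p) => -[s l] [/= s0 Kl].
    rewrite lerBlDl.
    (* The weights [t / (t + s)] and [s / (t + s)] used below need a nonzero denominator. *)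
    have [s_t0|s_t0] := eqVneq (t + s) 0.
      have [-> ->] : t = 0 /\ s = 0 by lra.
      apply: (le_trans (p_le _ (0, k) _)) => //.
      by rewrite /F/= !scale0r !subr0 !mul0r !subr0 ler_normD.
    have ts_gt0 : 0 < t + s by rewrite lt_neqAle eq_sym s_t0 addr_ge0.
    (* For the weighted mean [m] of [k] and [l], [(t + s) *: (x0 - m)] is
       [t *: (x0 - k) + s *: (x0 - l)]. *)
    apply: (le_trans (p_le _ (t + s, (t / (t + s)) *: k + (s / (t + s)) *: l) _)).
      split; first exact: addr_ge0.
      apply: Kconvex => //=.
      - by rewrite divr_ge0// ltW.
      - by rewrite divr_ge0// ltW.
      - by rewrite -mulrDl divff.
    rewrite /F/= [leRHS]addrACA -[in leRHS]opprD -[in leRHS]mulrDl lerD2r.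
    apply: le_trans (ler_normD _ _).
    rewrite !scalerBr [X in u + w - X](_ : _ =
      (t + s) *: x0 - (t *: k + s *: l)); last first.
      by rewrite scalerDr !scalerA !(mulrC (t + s)) !divfK.
    rewrite (_ : _ - (t *: k + s *: l) = (t *: x0 - t *: k) + (s *: x0 - s *: l)).
      by rewrite [in leRHS]addrACA -opprD.
    by rewrite scalerDl opprD addrACA.
  move: a0; rewrite le_eqVlt => /predU1P[<-|a0].
    rewrite scale0r mul0r; apply: (le_trans (p_le _ (0, k0) _)) => //.
    by rewrite /F/= scale0r subr0 mul0r normr0 subr0.
  rewrite -ler_pdivrMl//; apply: le_p => -[t k] [/= t0 Kk]; rewrite ler_pdivrMl//.
  apply: (le_trans (p_le _ (a * t, k) _)); first by split=> //=; rewrite mulr_ge0// ltW.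
  by rewrite /F/= -scalerA -scalerBr normrZ gtr0_norm// mulrBr mulrA.
have [phi lphi phip] := linear_le_sublinear _ sp.
have phi_le x : phi x <= `|x|.
  apply: (le_trans (phip x)); apply: (le_trans (p_le x (0, k0) _)) => //.
  by rewrite /F/= scale0r subr0 mul0r subr0.
exists (Dual (linear_le_norm_in_dual _ lphi phi_le)), r; split=> // k Kk /=.
have := phip (x0 - k); have := p_le (x0 - k) (1, k) (conj ler01 Kk).
rewrite /F/= scale1r subrr normr0 mul1r sub0r.
have -> : phi (x0 - k) = phi x0 - phi k.
  by rewrite -scaleN1r addrC lphi scaleN1r addrC.
lra.
Qed.

End separation.

(** This replaces weak compactness of bounded sets. Limits of functionals along an ultrafilter finer
    than [F] define an element of the bidual, reflexivity represents it by a point [x], and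
    separation puts [x] in every closed convex member of [F]. *)
Lemma reflexive_filter_meet {R : realType} (X : normedModType R)
    (F : set_system X) (B : set X) (M : R) :
  reflexive_space X -> ProperFilter F -> F B -> (forall x, B x -> `|x| <= M) ->
  exists x, forall K, F K -> closed K -> convex_set K -> K x.
Proof.
move=> Xrefl FF FB BM.
have [U [UU FU]] := ultraFilterLemma FF.
have UB : U B by exact: FU.
(* An ultrafilter turns pointwise limits into an element of the bidual. *)
have cvgU (phi : dual X) : exists l : R^o, phi @ U --> l.
  pose b := dual_norm phi * M.
  have phib x : B x -> `|phi x| <= b.
    move=> Bx; apply: le_trans (le_dual_norm phi x) _.
    by apply: ler_wpM2l; [exact: dual_norm_ge0|exact: BM].
  have Ub : (phi @ U) [set` `[- b, b]].
    by apply: (@filterS _ U _ B) => // x /phib; rewrite ler_norml /= in_itv.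
  have [l [_ cl]] := @segment_compact R _ _ _ _ Ub.
  (* A cluster point of an ultrafilter is a limit: otherwise some neighbourhood of it would have its
     complement in the ultrafilter. *)
  exists l => A lA; have [//|UnA] := in_ultra_setVsetC (phi @^-1` A) UU.
  by have [y [nAy Ay]] := cl (~` A) A UnA lA.
pose L (phi : dual X) : R^o := lim (phi @ U).
have LU (phi : dual X) : phi @ U --> L phi by apply/cvg_ex; exact: cvgU.
have Llin : linear L.
  move=> a phi psi; apply/cvg_lim => //.
  by apply: cvgD (LU psi); apply: cvgZr; exact: LU.
have Lbound (phi : dual X) : `|L phi| <= `|phi| * M.
  apply: (cvgr_to_le (cvg_norm (LU phi))).
  apply: (@filterS _ U _ B) => // x /BM xM; apply: le_trans (le_dual_norm phi x) _.
  by apply: ler_wpM2l; first exact: dual_norm_ge0.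
have Ldual : L \in @in_dual R (dual X).
  apply/asboolP; split=> //.
  pose g : {linear dual X -> R^o} :=
    HB.pack L (GRing.isLinear.Build R (dual X) R^o *:%R _ Llin).
  apply: (@bounded_linear_continuous _ _ _ g); apply/bounded_funP => r.
  (* The absolute value avoids discussing the sign of [M]. *)
  exists (r * `|M|) => phi phir; apply: le_trans (Lbound phi) _.
  apply: le_trans (ler_norm _) _; rewrite normrM normr_id.
  exact: ler_wpM2r.
have : range (@bidual_eval R X) (Dual Ldual) by rewrite Xrefl.
move=> [x _ xL]; exists x => K FK Kclosed Kconvex; apply: contrapT => nKx.
have [phi [r [r0 phiK]]] := convex_closed_separation _ _ Kclosed Kconvex nKx.
have Lx : L phi = phi x by rewrite -[L]/(dual_fun (Dual Ldual)) -xL.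
have : phi x + r <= L phi.
  apply: (cvgr_to_ge (LU phi)).
  by apply: (@filterS _ U _ K) => [k Kk|]; [exact: phiK|exact: FU].
rewrite Lx; lra.
Qed.

Lemma open_lt_mem {R : realType} (I : set R^o) (b : R^o) :
  open I -> I b -> exists2 a : R^o, I a & a < b.
Proof.
move=> Iopen Ib.
have /nbhs_ballP[e /= e0 eI] : nbhs b I by exact: open_nbhs_nbhs.
exists (b - e / 2); last by rewrite ltrBlDr ltrDl divr_gt0.
apply: eI; rewrite -ball_normE/= opprB addrC subrK gtr0_norm ?divr_gt0//.
by rewrite ltr_pdivrMr// ltr_pMr// ltr1n.
Qed.

(** If no element of [I] bounds [f] below on [K], the sets [S b] with [b] in [I] form a base of
    closed convex sets of a proper filter. A common point [x] then has [f x <= b] for all [b] in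
    [I], although [f x] lies in the open set [I]. *)
Lemma reflexive_convex_lower_bound {R : realType} (X : normedModType R)
    (K : set X) (M : R) (f : X -> R^o) (I : set R^o) :
  reflexive_space X -> closed K -> convex_set K ->
  (forall x, K x -> `|x| <= M) -> (forall x, K x -> {for x, continuous f}) ->
  convex_function K f -> open I -> I !=set0 -> f @` K `<=` I ->
  exists2 b, I b & forall x, K x -> b <= f x.
Proof.
move=> Xrefl Kclosed Kconvex KM fcont fconvex Iopen [b0 Ib0] fKI.
apply: contrapT => nb.
have fI b : I b -> exists2 x, K x & f x <= b.
  move=> Ib; apply: contrapT => nx; apply: nb; exists b => // x Kx.
  by rewrite leNgt; apply/negP => /ltW fxb; apply: nx; exists x.
pose S (b : R^o) := K `&` [set x | f x <= b].
have FF : ProperFilter (filter_from I S).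
  apply: filter_from_proper.
    apply: filter_from_filter; first by exists b0.
    move=> b c Ib Ic; exists (Num.min b c).
      by rewrite /Num.min; case: ifP.
    by move=> x [Kx /= fx]; move: fx; rewrite le_min => /andP[fb fc].
  by move=> b /fI[x Kx fxb]; exists x.
have Sclosed b : closed (S b).
  move=> x clx.
  have Kx : K x by apply: Kclosed; apply: closure_subset clx => ? [].
  split=> //=; rewrite leNgt; apply/negP => bfx.
  have nx : nbhs x (f @^-1` [set t | b < t]).
    by apply: fcont => //; exact: lt_nbhsr.
  have [y [[_ /= fyb] /= bfy]] := clx _ nx.
  by move: fyb; rewrite leNgt bfy.
have Sconvex b : convex_set (S b).
  apply/convex_setP => x y s t [Kx /= fx] [Ky /= fy] s0 t0 st; split.
    by move/convex_setP: Kconvex; apply.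
  move/convex_functionP : fconvex => /(_ x y s t Kx Ky s0 t0 st)/le_trans; apply.
  have -> : b = s * b + t * b by rewrite -mulrDl st mul1r.
  by rewrite lerD// ler_wpM2l.
have FK : filter_from I S K by exists b0 => // x [].
have [x xS] := reflexive_filter_meet _ _ _ _ Xrefl FF FK KM.
have Sx b : I b -> S b x by move=> Ib; apply: xS => //; exists b.
have [Kx _] := Sx _ Ib0.
have [b Ib bfx] := open_lt_mem _ _ Iopen (fKI _ (imageP f Kx)).
by have [_ /=] := Sx _ Ib; rewrite leNgt bfx.
Qed.

(** * Convex exhaustion of an open convex set *)

Section boundary_distance.
Context {R : realType} {X : normedModType R}.
Implicit Types (C : set X) (x y z v : X).

(* The constant 1 keeps the infimum meaningful when [C] is the whole space. *)
Definition boundary_dist C x : R :=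
  inf [set r | r = 1 \/ exists2 z, ~ C z & r = `|x - z|].

Lemma boundary_dist_lbound C x (r : R) :
  r = 1 \/ (exists2 z, ~ C z & r = `|x - z|) -> boundary_dist C x <= r.
Proof.
move=> rx; apply: ge_inf => //; exists 0 => s [->|[z _ ->]] //.
Qed.

Lemma le_boundary_dist C x a :
  a <= 1 -> (forall z, ~ C z -> a <= `|x - z|) -> a <= boundary_dist C x.
Proof.
move=> a1 aC; apply: lb_le_inf; first by exists 1; left.
by move=> r [->//|[z /aC az ->]].
Qed.

Lemma boundary_dist_le1 C x : boundary_dist C x <= 1.
Proof. by apply: boundary_dist_lbound; left. Qed.

Lemma boundary_dist_le C x z : ~ C z -> boundary_dist C x <= `|x - z|.
Proof. by move=> Cz; apply: boundary_dist_lbound; right; exists z. Qed.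

Lemma boundary_dist_mem C x v : `|v| < boundary_dist C x -> C (x + v).
Proof.
move=> vx; apply: contrapT => /(boundary_dist_le _ x).
by rewrite opprD addrA subrr sub0r normrN leNgt vx.
Qed.

Lemma boundary_dist_gt0_mem C x : 0 < boundary_dist C x -> C x.
Proof. by move=> x0; rewrite -[x]addr0; apply: boundary_dist_mem; rewrite normr0. Qed.

Lemma boundary_dist_gt0 C x : open C -> C x -> 0 < boundary_dist C x.
Proof.
move=> Copen Cx.
have /nbhs_ballP[e /= e0 eC] : nbhs x C by exact: open_nbhs_nbhs.
apply: (@lt_le_trans _ _ (Num.min e 1)); first by rewrite lt_min e0 ltr01.
apply: le_boundary_dist; first by rewrite ge_min lexx orbT.
move=> z nCz; rewrite ge_min; apply/orP; left; rewrite leNgt; apply/negP => xz.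
by apply: nCz; apply: eC; rewrite -ball_normE.
Qed.

Lemma boundary_dist_lipschitz C x y :
  boundary_dist C x - `|x - y| <= boundary_dist C y.
Proof.
apply: le_boundary_dist => [|z nCz].
  by rewrite lerBlDr (le_trans (boundary_dist_le1 _ _))// lerDl.
rewrite lerBlDr (le_trans (boundary_dist_le _ x _ nCz))//.
by rewrite [leRHS]addrC -(subrKA y x) ler_normD.
Qed.

Lemma boundary_dist_continuous C : continuous (boundary_dist C : X -> R^o).
Proof.
move=> x; apply/cvgrPdist_le => /= e e0; near=> y.
apply: (@le_trans _ _ `|x - y|); last first.
  by near: y; exact: (@cvgr_dist_le _ _ _ _ _ id x (@cvg_id _ _)).
have := boundary_dist_lipschitz C x y; have := boundary_dist_lipschitz C y x.
rewrite (distrC y x) ler_norml; lra.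
Unshelve. all: by end_near. Qed.

(** A displacement [v] shorter than [rho = s * dx + t * dy] can be shared out: [x] moves by
    [(dx / rho) *: v] and [y] by [(dy / rho) *: v]. Both stay in [C], and the combination moves by
    exactly [v]. *)
Lemma boundary_dist_concave C x y s t : open C -> convex_set C ->
  C x -> C y -> 0 <= s -> 0 <= t -> s + t = 1 ->
  s * boundary_dist C x + t * boundary_dist C y <=
    boundary_dist C (s *: x + t *: y).
Proof.
move=> Copen /convex_setP Cconvex Cx Cy s0 t0 st.
have dx0 := boundary_dist_gt0 _ _ Copen Cx.
have dy0 := boundary_dist_gt0 _ _ Copen Cy.
have dx1 := boundary_dist_le1 C x; have dy1 := boundary_dist_le1 C y.
set dx := boundary_dist C x in dx0 dx1 *.
set dy := boundary_dist C y in dy0 dy1 *.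
apply: le_boundary_dist => [|w nCw].
  have := ler_wpM2l s0 dx1; have := ler_wpM2l t0 dy1; lra.
rewrite leNgt; apply/negP => zw; apply: nCw.
set rho := s * dx + t * dy in zw.
have rho0 : 0 < rho by apply: le_lt_trans zw.
have [v vE] : exists v, v = w - (s *: x + t *: y) by eexists.
have vrho : `|v| < rho by rewrite vE distrC.
have vC u (d := boundary_dist C u) : C u -> C (u + (d / rho) *: v).
  move=> Cu; apply: boundary_dist_mem.
  have d0 : 0 < d by exact: boundary_dist_gt0.
  rewrite normrZ gtr0_norm ?divr_gt0// mulrAC ltr_pdivrMr//.
  by rewrite ltr_pM2l.
have -> : w = s *: (x + (dx / rho) *: v) + t *: (y + (dy / rho) *: v).
  rewrite !scalerDr addrACA !scalerA -(scalerDl v) !mulrA -mulrDl divff ?gt_eqF//.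
  by rewrite scale1r vE addrC subrK.
by apply: Cconvex => //; exact: vC.
Qed.

End boundary_distance.

(** The form with [c] merges convexity and antitonicity of the inverse, so that it applies to the
    inverse of a positive concave function. *)
Lemma invr_convex {R : realFieldType} (a b c s t : R) :
  0 < a -> 0 < b -> 0 <= s -> 0 <= t -> s + t = 1 -> s * a + t * b <= c ->
  c^-1 <= s / a + t / b.
Proof.
move=> a0 b0 s0 t0 st abc.
have ab0 : 0 < s * a + t * b.
  have [s00|s_neq0] := eqVneq s 0.
    by have -> : t = 1; [lra|rewrite s00 mul0r add0r mul1r].
  apply: ltr_pwDl; last by rewrite mulr_ge0// ltW.
  by rewrite mulr_gt0// lt_neqAle eq_sym s_neq0.
apply: (@le_trans _ _ (s * a + t * b)^-1).
  by rewrite lef_pV2// posrE// (lt_le_trans ab0).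
rewrite -[leLHS]mul1r ler_pdivrMr//.
have -> : (s / a + t / b) * (s * a + t * b) =
    (s + t) ^+ 2 + s * t * (a - b) ^+ 2 / (a * b).
  by field; rewrite !gt_eqF.
rewrite st expr1n lerDl divr_ge0//; last by rewrite mulr_ge0// ltW.
by rewrite mulr_ge0 ?sqr_ge0// mulr_ge0.
Qed.

(* Reflecting [x] through a point [x0] near which [f] is bounded above. *)
Lemma convex_linear_lower_bound {R : realType} (X : normedModType R)
    (C : set X) (f : X -> R^o) :
  open C -> {in C, continuous f} -> convex_function C f ->
  exists2 K, 1 <= K & forall x, C x -> - (K * (1 + `|x|)) <= f x.
Proof.
move=> Copen fcont /convex_functionP fconvex.
have [[x0 Cx0]|/nonemptyPn C0] := pselect (C !=set0); last first.
  by exists 1 => // x; rewrite C0.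
have : \forall x \near x0, C x /\ f x <= f x0 + 1.
  near=> x; split; first by near: x; exact: open_nbhs_nbhs.
  near: x; apply: (cvgr_le (f x0)); last by rewrite ltrDl.
  exact: (fcont _ (mem_set Cx0)).
move=> /nbhs_ballP[e /= e0 eP].
pose r := e / 2.
have r0 : 0 < r by rewrite divr_gt0.
have re : r < e by rewrite /r ltr_pdivrMr// ltr_pMr// ltr1n.
(* The summand 1 gives [1 <= K], the second absorbs [f x0], and the last bounds
   [tau^-1 = (1 + |x0 - x|) / r]. *)
exists (1 + `|f x0| + (1 + `|x0|) / r) => [|x Cx].
  by rewrite -addrA lerDl addr_ge0// divr_ge0// ?ltW// addr_ge0.
pose D := 1 + `|x0 - x|.
have D0 : 0 < D by rewrite /D ltr_pwDl.
pose tau := r / D.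
have tau0 : 0 < tau by rewrite divr_gt0.
pose y := x0 + tau *: (x0 - x).
have [Cy fy] : C y /\ f y <= f x0 + 1.
  apply: eP; rewrite -ball_normE/= /y opprD addrA subrr sub0r normrN normrZ.
  rewrite gtr0_norm//; apply: le_lt_trans re.
  by rewrite /tau mulrAC ler_pdivrMr// ler_pM2l// /D lerDr.
have T0 : 0 < 1 + tau by rewrite addr_gt0.
have s0 : 0 <= tau / (1 + tau) by rewrite divr_ge0// ltW.
have t0 : 0 <= (1 + tau)^-1 by rewrite invr_ge0 ltW.
have st : tau / (1 + tau) + (1 + tau)^-1 = 1 by field; rewrite gt_eqF.
(* The reflected point [y] is within [r] of [x0], and [x0] is the combination of [x] and [y] with
   these weights. *)
have := fconvex x y _ _ Cx Cy s0 t0 st.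
have -> : (tau / (1 + tau)) *: x + (1 + tau)^-1 *: y = x0.
  rewrite /y [tau / _]mulrC -scalerA -scalerDr scalerBr addrCA.
  rewrite [tau *: x + _]addrC subrK -{1}[x0]scale1r -scalerDl scalerA.
  by rewrite mulVf ?scale1r ?gt_eqF.
rewrite mulrAC -[_^-1 * f y]mulrC -mulrDl ler_pdivlMr// => fx0.
have fx : f x0 * tau - 1 <= tau * f x by lra.
have {}fx : f x0 - tau^-1 <= f x.
  by rewrite -(ler_pM2l tau0) mulrBr divff ?gt_eqF// mulrC.
apply: le_trans fx.
have tauE : tau^-1 <= (1 + `|x0|) / r * (1 + `|x|).
  rewrite /tau invf_div mulrAC ler_pM2r ?invr_gt0// /D.
  have := ler_normB x0 x; have := mulr_ge0 (normr_ge0 x0) (normr_ge0 x); lra.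
have := ler_norm (- f x0); rewrite normrN.
have := mulr_ge0 (normr_ge0 (f x0)) (normr_ge0 x); have := normr_ge0 x.
lra.
Unshelve. all: by end_near. Qed.

(* [W] blows up both at infinity and at the boundary of [C]. *)
Lemma convex_exhaustion {R : realType} (X : normedModType R)
    (C : set X) (f : X -> R^o) :
  open C -> convex_set C -> {in C, continuous f} -> convex_function C f ->
  exists W : X -> R^o, [/\ {in C, continuous W}, convex_function C W,
    forall x, C x -> `|f x| <= W x, forall x, C x -> `|x| <= W x &
    forall M, closed (C `&` [set x | W x <= M])].
Proof.
move=> Copen Cconvex fcont fconvex.
have [K K1 fK] := convex_linear_lower_bound _ _ _ Copen fcont fconvex.
pose d := boundary_dist C.
have d0 x : C x -> 0 < d x by exact: boundary_dist_gt0.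
(* One copy of [K * (1 + |x|)] compensates a negative [f x]; the second dominates the norm and gives
   [- f x <= W x]. The inverse distance keeps sublevel sets away from the boundary. *)
pose W : X -> R^o := fun x => f x + K * (1 + `|x|) *+ 2 + (d x)^-1.
have Wge x : C x -> K * (1 + `|x|) + (d x)^-1 <= W x.
  by move=> Cx; have := fK _ Cx; rewrite /W; lra.
have xK (x : X) : `|x| <= K * (1 + `|x|).
  apply: (@le_trans _ _ (1 + `|x|)); first by rewrite lerDr.
  by rewrite ler_peMl// addr_ge0.
have Wcont : {in C, continuous W}.
  move=> x Cx; apply: cvgD; last first.
    apply: cvgV; first by rewrite gt_eqF// d0//; exact: set_mem.
    exact: boundary_dist_continuous.
  apply: cvgD; first exact: fcont.
  apply: cvgMn; apply: cvgMr; apply: cvgD; first exact: cvg_cst.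
  exact: cvg_norm.
exists W; split=> //.
- apply/convex_functionP => x y s t Cx Cy s0 t0 st.
  move/convex_functionP : fconvex => /(_ x y s t Cx Cy s0 t0 st) fxy.
  have dxy : (d (s *: x + t *: y))^-1 <= s / d x + t / d y.
    by apply: invr_convex => //; [exact: d0|exact: d0|exact: boundary_dist_concave].
  have nxy : `|s *: x + t *: y| <= s * `|x| + t * `|y|.
    by rewrite (le_trans (ler_normD _ _))// !normrZ !ger0_norm.
  have : K * (1 + `|s *: x + t *: y|) <=
      s * (K * (1 + `|x|)) + t * (K * (1 + `|y|)).
    rewrite !(mulrCA _ K) -mulrDr ler_pM2l ?(lt_le_trans ltr01)// !mulrDr !mulr1.
    by rewrite addrACA st lerD2l.
  rewrite /W; lra.
- move=> x Cx; rewrite ler_norml; have := fK _ Cx; have := Wge _ Cx.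
  have := d0 _ Cx; rewrite -invr_gt0 /W.
  have := xK x; have := normr_ge0 x; lra.
- move=> x Cx; have := Wge _ Cx; have := xK x.
  by have := d0 _ Cx; rewrite -invr_gt0; lra.
move=> M x clx.
(* The bound [M^-1 <= d] passes to limits by continuity of [d], so closure points of the sublevel
   set remain in [C]. *)
have dM y : C y -> W y <= M -> 0 < M /\ M^-1 <= d y.
  move=> Cy WM; have dy := d0 _ Cy; have dyV : 0 < (d y)^-1 by rewrite invr_gt0.
  have dyM : (d y)^-1 <= M.
    by have := Wge _ Cy; have := xK y; have := normr_ge0 y; lra.
  have M0 : 0 < M by exact: lt_le_trans dyM.
  by split=> //; rewrite -[d y]invrK lef_pV2// posrE.
have [y [[Cy /= Wy] _]] := clx _ (filterT : nbhs x setT).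
have [M0 _] := dM _ Cy Wy.
have Cx : C x.
  apply: boundary_dist_gt0_mem; apply: (@lt_le_trans _ _ M^-1); first by rewrite invr_gt0.
  rewrite leNgt; apply/negP => dxM.
  have nx : nbhs x (d @^-1` [set r | r < M^-1]).
    by apply: boundary_dist_continuous; exact: lt_nbhsl.
  have [z [[Cz /= Wz] /= dz]] := clx _ nx.
  by have [_] := dM _ Cz Wz; rewrite leNgt dz.
split=> //=; rewrite leNgt; apply/negP => MWx.
have nx : nbhs x (W @^-1` [set r | M < r]).
  by apply: (Wcont _ (mem_set Cx)); exact: lt_nbhsr.
have [z [[_ /= Wz] /= zM]] := clx _ nx.
by move: zM; rewrite ltNge Wz.
Qed.

(** * The control function of the composition *)

(** Writing [s] as [l * a + m * t] with [m > 0], convexity gives [r s <= l * r a + m * r t <= l * r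
    s + m * r t]. *)
Lemma convex_le_right {R : realType} (I : set R^o) (r : R^o -> R^o) (a s t : R^o) :
  convex_function I r -> I a -> I t -> a < s -> s <= t -> r a <= r s -> r s <= r t.
Proof.
move=> /convex_functionP rI Ia It as_ st ras.
have at0 : 0 < t - a by rewrite subr_gt0 (lt_le_trans as_).
have [l lE] : exists l, l = (t - s) / (t - a) by eexists.
have [m mE] : exists m, m = (s - a) / (t - a) by eexists.
have l0 : 0 <= l by rewrite lE divr_ge0 ?subr_ge0// ltW// -subr_gt0.
have m0 : 0 < m by rewrite mE divr_gt0// subr_gt0.
have lm : l + m = 1 by rewrite lE mE; field; rewrite gt_eqF.
have sE : l *: (a : R^o) + m *: (t : R^o) = s.
  by rewrite lE mE /GRing.scale/=; field; rewrite gt_eqF.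
have := rI a t _ _ Ia It l0 (ltW m0) lm; rewrite sE => rs.
have lrs := ler_wpM2l l0 ras.
have : (l + m) * r s = r s by rewrite lm mul1r.
by rewrite -[r s <= r t](ler_pM2l m0); lra.
Qed.

(** Openness gives [a < b] in [I]. The slope of [y \o G + g] from [a] to [b] is bounded below
    uniformly in [|y| <= 1]; [l] offsets this bound, and convexity propagates the inequality between
    [a] and [b] to the right. *)
Lemma dc_eventually_increasing {R : realType} {Z : normedModType R}
    (I : set R^o) (G : R^o -> Z) (g : R^o -> R^o) (b : R^o) :
  open I -> control_function I G g -> I b ->
  exists2 l : R, 0 <= l & forall (y : dual Z) s t, `|y| <= 1 ->
    I s -> I t -> b <= s -> s <= t ->
    y (G s) + g s + l * s <= y (G t) + g t + l * t.
Proof.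
move=> Iopen [_ gconvex] Ib; have [a Ia ab] := open_lt_mem _ _ Iopen Ib.
have ba0 : 0 < b - a by rewrite subr_gt0.
pose l := (`|G a - G b| + `|g a - g b|) / (b - a).
have l0 : 0 <= l by apply: divr_ge0; [exact: addr_ge0|exact: ltW].
exists l => // y s t y1 Is It bs st.
pose r : R^o -> R^o := fun u => y (G u) + g u + l * u.
have rconvex : convex_function I r.
  apply/convex_functionP => u v c e Iu Iv c0 e0 ce.
  move/convex_functionP : (gconvex y y1) => /(_ u v c e Iu Iv c0 e0 ce).
  by rewrite /r [_ *: u]/GRing.scale [_ *: v]/GRing.scale/=; lra.
have rab : r a <= r b.
  have yab : y (G a) - y (G b) <= `|G a - G b|.
    rewrite -linearB; apply: (le_trans (ler_norm _)).
    apply: (le_trans (le_dual_norm _ _)).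
    by rewrite ler_piMl.
  have := ler_norm (g a - g b).
  have : l * (b - a) = `|G a - G b| + `|g a - g b| by rewrite /l divfK// gt_eqF.
  rewrite /r; lra.
have as_ : a < s by exact: lt_le_trans bs.
have rbs : r b <= r s by exact: convex_le_right rconvex Ia Is ab bs rab.
exact: convex_le_right rconvex Ia It as_ st (le_trans rab rbs).
Qed.

(** * Locally finite sums along the levels of [W] *)

Section locally_finite_sum.
Context {R : realType} {X : normedModType R}.
Variables (C : set X) (W : X -> R^o) (u : nat -> X -> R^o).
Hypothesis uW : forall i x, C x -> W x <= i%:R -> u i.+1 x = 0.

(** This is the whole series on [C]: since [W x < truncn (W x) + 1], the terms of index at least
    [truncn (W x) + 2] vanish by [uW]. *)
Definition locally_finite_sum (x : X) : R^o :=
  \sum_(i < (Num.truncn (W x)).+2) u i x.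

Lemma locally_finite_sumE n x : C x -> W x <= n%:R ->
  locally_finite_sum x = \sum_(i < n.+1) u i x.
Proof.
move=> Cx Wn; rewrite /locally_finite_sum.
rewrite -!(big_mkord xpredT (fun i => u i x)).
have vanish m k : W x <= m%:R -> (m <= k)%N ->
    \sum_(0 <= i < k.+1) u i x = \sum_(0 <= i < m.+1) u i x.
  move=> Wm mk; rewrite (big_cat_nat (n := m.+1))//=.
  rewrite [X in _ + X]big_nat_cond [X in _ + X]big1 ?addr0// => -[//|i] /andP[/andP[mi _] _].
  by apply: uW => //; apply: le_trans Wm _; rewrite ler_nat.
have Wt : W x <= (Num.truncn (W x)).+1%:R by rewrite ltW// truncnS_gt.
have [le|/ltnW le] := leqP n (Num.truncn (W x)).+1; first exact: vanish.
exact/esym/vanish.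
Qed.

(** Near [x] the function [W] stays below one integer [n], so the number of summands can be fixed
    there. *)
Lemma locally_finite_sum_continuous : open C -> {in C, continuous W} ->
  (forall i, {in C, continuous (u i)}) -> {in C, continuous locally_finite_sum}.
Proof.
move=> Copen Wcont ucont x Cx.
set n := (Num.truncn (W x)).+1.
have Wn : W x < n%:R by exact: truncnS_gt.
have Sn : \forall y \near x, \sum_(i < n.+1) u i y = locally_finite_sum y.
  near=> y; apply/esym/locally_finite_sumE.
    by near: y; apply: open_nbhs_nbhs; split=> //; exact: set_mem.
  by near: y; apply: (cvgr_le (W x)) => //; exact: Wcont.
apply/(cvg_trans (near_eq_cvg Sn)).
rewrite (locally_finite_sumE n) ?ltW//; last exact: set_mem.
by apply: cvg_big => [|i _]; [exact: add_continuous|exact: ucont].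
Unshelve. all: by end_near. Qed.

End locally_finite_sum.

(** * Convex increments attached to the levels of [W] *)

Section increments.
Context {R : realType} {X : normedModType R}.
Variables (C : set X) (f W : X -> R^o) (l : nat -> R).
Hypothesis l_ge0 : forall n, 0 <= l n.
Hypothesis f_le_W : forall x, C x -> `|f x| <= W x.

(* Since [|f| <= W], this is nonnegative where [n <= W] and nonpositive where
   [W <= n - 1]. *)
Definition increment n (x : X) : R^o :=
  l n * (f x + (n.*2.+1)%:R * W x - (2 * n ^ 2)%:R).

Definition increment_pos n (x : X) : R^o := Num.max (increment n x) 0.

(** From [f >= - W] the bracket is at least [2 n (W - n)]. *)
Lemma increment_posE n x : C x -> n%:R <= W x ->
  increment_pos n x = increment n x.
Proof.
move=> Cx nW; apply/max_idPl; apply: mulr_ge0 => //.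
have := f_le_W _ Cx; rewrite ler_norml => /andP[fW _].
have := ler_wpM2l (ler0n R n) nW.
rewrite -addn1 -muln2 natrD !natrM; lra.
Qed.

(** From [f <= W] the bracket of index [n + 1] is at most [2 (n + 2) W - 2 (n + 1)^2], which is at
    most -2 when [W <= n]. *)
Lemma increment_pos_eq0 n x : C x -> W x <= n%:R -> increment_pos n.+1 x = 0.
Proof.
move=> Cx nW; apply/max_idPr; apply: mulr_ge0_le0 => //.
have := f_le_W _ Cx; rewrite ler_norml => /andP[_ fW].
have := ler_wpM2l (ler0n R n) nW.
rewrite -addn1 -muln2 -(addn1 n) !natrD !natrM !natrD; lra.
Qed.

Lemma increment_pos_continuous n : {in C, continuous f} -> {in C, continuous W} ->
  {in C, continuous (increment_pos n)}.
Proof.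
move=> fcont Wcont x Cx; apply: continuous_max; last exact: cvg_cst.
apply: cvgMr; apply: cvgB; last exact: cvg_cst.
by apply: cvgD; [exact: fcont|apply: cvgMr; exact: Wcont].
Qed.

Lemma increment_pos_convex n : convex_function C f -> convex_function C W ->
  convex_function C (increment_pos n).
Proof.
move=> /convex_functionP fconvex /convex_functionP Wconvex.
apply/convex_functionP => x y s t Cx Cy s0 t0 st.
have fxy := fconvex x y s t Cx Cy s0 t0 st.
have Wxy := Wconvex x y s t Cx Cy s0 t0 st.
rewrite /increment_pos ge_max; apply/andP; split; last first.
  by rewrite addr_ge0// mulr_ge0// le_max lexx orbT.
apply: (@le_trans _ _ (s * increment n x + t * increment n y)); last first.
  by rewrite lerD// ler_wpM2l// le_max lexx.
rewrite /increment !(mulrCA _ (l n)) -mulrDr ler_wpM2l//.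
have := ler_wpM2l (ler0n R n.*2.+1) Wxy.
set c := (n.*2.+1)%:R; set e := (2 * n ^ 2)%:R => cW.
have : (s + t) * e = e by rewrite st mul1r.
lra.
Qed.

End increments.

Theorem proposition3p4 (R : realType) (X : completeNormedModType R)
    (Xreflexive : reflexive_space X)
    (C : set X) (Copen : open C) (Cconvex : convex_set C)
    (f : X -> R^o) (fcontinuous : {within C, continuous f})
    (fconvex : convex_function C f)
    (I : set R^o) (Iopen : open I) (Iinterval : is_interval I)
    (fCI : f @` C `<=` I)
    (Z : normedModType R) (G : R^o -> Z) :
  dc_mapping I G -> dc_mapping C (G \o f).
Proof.
move=> [Gcont [g gG]]; have [gcont _] := gG.
move: fcontinuous Gcont gcont.
rewrite !continuous_open_subspace// => fcont Gcont gcont.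
have fI x : C x -> I (f x) by move=> Cx; apply: fCI; exists x.
have comp_cont (Y : topologicalType) (h : R^o -> Y) :
    {in I, continuous h} -> {in C, continuous (h \o f)}.
  move=> hcont x /set_mem Cx; apply: continuous_comp; first exact/fcont/mem_set.
  exact/hcont/mem_set/fI.
split; first by rewrite continuous_open_subspace//; exact: comp_cont.
(* A point of [C] provides the point of [I] that the lower bound for [f] requires. *)
have [C0|/nonemptyPn C0] := pselect (C !=set0); last first.
  exists (fun=> 0); split; first by rewrite C0; exact: continuous_subspace0.
  by move=> y _; apply/convex_functionP => x z s t; rewrite C0.
have I0 : I !=set0 by have [x /fI] := C0; exists (f x).
have [W [Wcont Wconvex fW xW Wclosed]] :=
  convex_exhaustion _ _ _ Copen Cconvex fcont fconvex.
have lP n : exists l : R, 0 <= l /\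
    forall (y : dual Z) x t, `|y| <= 1 -> C x -> W x <= n.+1%:R -> I t ->
    f x <= t -> y (G (f x)) + g (f x) + l * f x <= y (G t) + g t + l * t.
  pose K := C `&` [set x | W x <= n.+1%:R].
  have Kconvex : convex_set K.
    apply/convex_setP => x y s t [Cx /= Wx] [Cy /= Wy] s0 t0 st; split.
      by move/convex_setP: Cconvex; apply.
    move/convex_functionP : Wconvex => /(_ x y s t Cx Cy s0 t0 st)/le_trans; apply.
    have -> : n.+1%:R = s * n.+1%:R + t * n.+1%:R :> R by rewrite -mulrDl st mul1r.
    by rewrite lerD// ler_wpM2l.
  have [b Ib bf] : exists2 b, I b & forall x, K x -> b <= f x.
    apply: (reflexive_convex_lower_bound _ K n.+1%:R) => //.
    - exact: Wclosed.
    - by move=> x [Cx /= Wx]; apply: le_trans Wx; exact: xW.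
    - by move=> x [Cx _]; exact/fcont/mem_set.
    - apply/convex_functionP => x y s t [Cx _] [Cy _].
      by move/convex_functionP : fconvex; apply.
    - by move=> _ [x [Cx _] <-]; exact: fI.
  have [l l0 lG] := dc_eventually_increasing _ _ _ _ Iopen gG Ib.
  exists l; split=> // y x t y1 Cx Wx It fxt.
  by apply: lG => //; [exact: fI|apply: bf].
have [l /all_and2[l0 lG]] := choice lP.
pose u := increment_pos f W l.
have uW := increment_pos_eq0 _ _ _ _ l0 fW.
have uconvex i : convex_function C (u i) by exact: increment_pos_convex.
pose H := locally_finite_sum W u.
have Hcont : {in C, continuous H}.
  apply: (locally_finite_sum_continuous _ _ _ uW) => // i.
  exact: increment_pos_continuous.
exists (fun x => g (f x) + H x); split.
  rewrite continuous_open_subspace// => x Cx; apply: cvgD; last exact: Hcont.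
  exact: (comp_cont _ g).
move=> y y1; apply/convex_functionP => x1 x2 s t Cx1 Cx2 s0 t0 st /=.
set z := s *: x1 + t *: x2.
have Cz : C z by move/convex_setP: Cconvex; apply.
(* At this level [u j] equals its increment at [z], as [j <= W z], and [lG j] is available at [z],
   as [W z <= j + 1]. *)
pose j := Num.truncn (W z).
have Wz0 : 0 <= W z by apply: le_trans (fW _ Cz).
have jW : j%:R <= W z by rewrite /j truncn_le.
have Wj : W z <= j.+1%:R by rewrite ltW// truncnS_gt.
(* A common length for the three sums allows a term by term comparison. *)
pose n := maxn j (maxn (Num.truncn (W x1)) (Num.truncn (W x2))).
have Hn x : C x -> (Num.truncn (W x) <= n)%N -> H x = \sum_(i < n.+2) u i x.
  move=> Cx xn; apply: (locally_finite_sumE _ _ _ uW) => //.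
  by rewrite (le_trans (ltW (truncnS_gt _)))// ler_nat.
have jn : (j < n.+2)%N by rewrite ltnS leqW// leq_maxl.
rewrite !Hn// ?leq_maxl//; last 2 first.
- by rewrite /n !leq_max leqnn !orbT.
- by rewrite /n !leq_max leqnn !orbT.
have split_j x : \sum_(i < n.+2) u i x =
    u j x + \sum_(i < n.+2 | i != Ordinal jn) u i x.
  by rewrite (bigD1 (Ordinal jn)).
rewrite !split_j.
have rest : \sum_(i < n.+2 | i != Ordinal jn) u i z <=
    s * (\sum_(i < n.+2 | i != Ordinal jn) u i x1) +
    t * (\sum_(i < n.+2 | i != Ordinal jn) u i x2).
  rewrite !mulr_sumr -big_split ler_sum// => i _.
  by move/convex_functionP : (uconvex i); exact.
have fz : f z <= s * f x1 + t * f x2.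
  by move/convex_functionP : fconvex; exact.
pose w := s * f x1 + t * f x2.
have Iw : I w.
  have stM a : s * a + t * a = a by rewrite -mulrDl st mul1r.
  have [f12|/ltW f21] := leP (f x1) (f x2).
    apply: (Iinterval _ _ (fI _ Cx1) (fI _ Cx2)).
    by rewrite -(stM (f x1)) -(stM (f x2)) /w lerD2l lerD2r !ler_wpM2l.
  apply: (Iinterval _ _ (fI _ Cx2) (fI _ Cx1)).
  by rewrite -(stM (f x2)) -(stM (f x1)) /w lerD2r lerD2l !ler_wpM2l.
(* Monotonicity replaces [f z] by the larger value [w], where convexity of [y \o G + g] on [I] can
   be used. *)
have Gw := lG j y z w y1 Cz Wj Iw fz.
have [_ gconvex] := gG.
have gw : y (G w) + g w <=
    s * (y (G (f x1)) + g (f x1)) + t * (y (G (f x2)) + g (f x2)).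
  move/convex_functionP : (gconvex y y1) => /(_ _ _ s t _ _ s0 t0 st); apply.
    exact: fI.
  exact: fI.
have Wz : W z <= s * W x1 + t * W x2 by move/convex_functionP : Wconvex; exact.
(* Equality is needed at [z], to release the term [l j * f z]; at [x1] and [x2] the positive part
   only enlarges the right-hand side. *)
have uz : u j z = increment f W l j z by exact: (increment_posE C).
have ux x : increment f W l j x <= u j x by rewrite /u /increment_pos le_max lexx.
have := ler_wpM2l s0 (ux x1); have := ler_wpM2l t0 (ux x2).
rewrite uz /increment /w in Gw gw *.
set c := (j.*2.+1)%:R; set e := (2 * j ^ 2)%:R.
have c0 : 0 <= c :> R by exact: ler0n.
have := ler_wpM2l (mulr_ge0 (l0 j) c0) Wz.
have : (s + t) * (l j * e) = l j * e by rewrite st mul1r.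
lra.
Qed.
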